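(* Consider configuration models satisfying the degree conditions stated in the context, with limiting degree $D\sim\boldsymbol p=(p_j)_{j\ge1}$ and $\nu=\mathbb{E}[D(D-1)]/\mathbb{E}[D]>1$. Let $\boldsymbol r=(r_j)_{j\ge1}$ and $\boldsymbol r'=(r'_j)_{j\ge1}$ be two $\alpha$-sequences such that $\boldsymbol r'\preccurlyeq_{\boldsymbol p}\boldsymbol r$. Then $$\rho(\bar{\boldsymbol r}(\alpha))\le\rho(\boldsymbol r)\le\rho(\boldsymbol r')\le\rho(\underline{\boldsymbol r}(\alpha))\quad\text{and}\quad e(\bar{\boldsymbol r}(\alpha))\le e(\boldsymbol r)\le e(\boldsymbol r')\le e(\underline{\boldsymbol r}(\alpha)).$$ As a result, the critical $\alpha$'s for the bottom and top vertex removal satisfy $\underline\alpha_c>\bar\alpha_c$.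
   Context: Configuration model: given a degree sequence $\boldsymbol d=(d_1,\dots,d_n)\in\mathbb{N}^n$ (with even sum), $\mathrm{CM}_n(\boldsymbol d)$ is the random multigraph on $\{1,\dots,n\}$ obtained by attaching $d_v$ half-edges to each vertex $v$ and matching the half-edges via a uniform perfect matching. With $n_j=\#\{v:d_v=j\}$, the degree conditions are: there is a probability distribution $\boldsymbol p=(p_j)_{j\ge1}$ such that (a) $\lim_{n\to\infty}n_j/n=p_j$; (b) $\lim_{n\to\infty}\sum_{j\ge1}jn_j/n=\sum_{j\ge1}jp_j<\infty$. $D$ has probability mass function $(p_j)_{j\ge1}$. $\alpha$-sequence: for $\alpha\in(0,1)$, a sequence $\boldsymbol r=(r_j)_{j\ge1}$ in $[0,1]$ is an $\alpha$-sequence with respect to $\boldsymbol p$ if $\mathbb{E}[r_D]=\sum_{i\ge1}p_ir_i=\alpha$. Order: $\boldsymbol r'\preccurlyeq_{\boldsymbol p}\boldsymbol r$ means that the finite measure $(p_jr'_j)_{j\ge1}$ is stochastically dominated by $(p_jr_j)_{j\ge1}$, i.e. $\sum_{j\ge K}p_jr'_j\le\sum_{j\ge K}p_jr_j$ for every $K$. For an $\alpha$-sequence $\boldsymbol r$, $$\rho(\boldsymbol r)=1-\alpha-2\mathbb{E}[Dr_D]\eta_{\boldsymbol r}-\sum_{i\ge1}(1-r_i)p_i\eta_{\boldsymbol r}^i,\qquad e(\boldsymbol r)=\frac{\mathbb{E}[D]}{2}(1-\eta_{\boldsymbol r}^2)-\mathbb{E}[Dr_D](1-\eta_{\boldsymbol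 r}),$$ where $\eta_{\boldsymbol r}\in(0,1]$ is the smallest solution of $g_{\boldsymbol r}'(\eta_{\boldsymbol r})=\frac{\mathbb{E}[D]}{\beta_{\boldsymbol r}}\eta_{\boldsymbol r}$, with $\beta_{\boldsymbol r}=\mathbb{E}[Dr_D]+1-\alpha$ and $g_{\boldsymbol r}(s)=\beta_{\boldsymbol r}^{-1}\big(\sum_{i\ge1}(1-r_i)p_is^i+\mathbb{E}[Dr_D]s\big)$. These are the limits in probability of the numbers of vertices and edges, divided by $n$, in the giant component after removing, for each $i$, a proportion $r_i$ of the degree-$i$ vertices uniformly at random. Quantiles: for $\alpha\in(0,1)$, the top $\alpha$-quantile $k_\alpha$ satisfies $\mathbb{P}(D>k_\alpha)<\alpha$ and $\mathbb{P}(D\ge k_\alpha)\ge\alpha$; the bottom $\alpha$-quantile $l_\alpha$ satisfies $\mathbb{P}(D<l_\alpha)<\alpha$ and $\mathbb{P}(D\le l_\alpha)\ge\alpha$. $\bar{\boldsymbol r}(\alpha)$ (top $\alpha$-removal) has coordinates $0$ for $i<k_\alpha$, $(\alpha-\mathbb{P}(D>k_\alpha))/p_{k_\alpha}$ for $i=k_\alpha$, $1$ for $i>k_\alpha$. $\underline{\boldsymbol r}(\alpha)$ (bottom $\alpha$-removal) has coordinates $1$ for $i<l_\alpha$, $(\alpha-\mathbb{P}(D<l_\alpha))/p_{l_\alpha}$ for $i=l_\alpha$, $0$ for $i>l_\alpha$. Critical values: $$\bar\alpha_c=\sup\{\alpha>0:\mathbb{E}[D(D-1)\mathbf 1\{D\le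 k_\alpha\}]>\mathbb{E}[D]+k_\alpha(k_\alpha-1)(\alpha-\mathbb{P}(D>k_\alpha))\},$$ $$\underline\alpha_c=\sup\{\alpha>0:\mathbb{E}[D(D-1)\mathbf 1\{D\ge l_\alpha\}]>\mathbb{E}[D]+l_\alpha(l_\alpha-1)(\alpha-\mathbb{P}(D<l_\alpha))\}.$$
   Formalization: The strict inequality between the critical values is stated only for D not almost surely constant; for D = d constant with d ≥ 3, top and bottom removal coincide and both critical values equal (d−2)/(d−1), so the claim fails there. *)

(* Defs.v *)
From HB Require Import structures.
From mathcomp Require Import all_boot all_order all_algebra.
From mathcomp Require Import all_classical all_reals all_analysis.

Set Implicit Arguments.
Unset Strict Implicit.
Unset Printing Implicit Defensive.

Import Order.TTheory GRing.Theory Num.Theory.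
Import numFieldNormedType.Exports.

Local Open Scope classical_set_scope.
Local Open Scope ring_scope.

(* A sequence (x_j)_{j >= 1} is a function nat -> R whose value at 0 is never
   used: every sum and every quantifier over indices starts at 1. *)

Section DegreeDistribution.
Variable R : realType.
Implicit Types (p r : nat -> R) (a : R).

Definition is_pmf p : Prop :=
  (forall j, (1 <= j)%N -> 0 <= p j) /\
  (\sum_(1 <= j <oo) (p j)%:E = 1)%E.

(* E[f(D)] for D with mass function p. It is taken in \bar R because
   E[D(D-1)] may be infinite. *)
Definition expect p (f : nat -> R) : \bar R :=
  (\sum_(1 <= j <oo) (p j * f j)%:E)%E.

Definition prob p (A : pred nat) : \bar R := expect p (fun j => (A j)%:R).

Definition mean p : \bar R := expect p (fun j => j%:R).

Definition nu p : \bar R :=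
  (expect p (fun j => (j * j.-1)%N%:R%R) / mean p)%E.

(* D is not almost surely constant. If it is constant, both quantiles equal
   that constant for every a, top and bottom removal coincide, and
   alpha_c_top p = alpha_c_bottom p. *)
Definition nonconstant_degree p : Prop := forall j, (1 <= j)%N -> p j != 1.

(* Degree sequences are indexed by the number n of vertices. *)
Definition count_degree n (d : 'I_n -> nat) (j : nat) : nat :=
  #|[pred v | d v == j]|.

Definition degree_conditions (d : forall n, 'I_n -> nat) p : Prop :=
  [/\ forall n, ~~ odd (\sum_(v < n) d n v),
      is_pmf p,
      forall j, (1 <= j)%N ->
        (count_degree (d n) j)%:R / n%:R @[n --> \oo] --> p j,
      (\sum_(1 <= j <oo) (j%:R * (count_degree (d n) j)%:R / n%:R)%:E)%E
        @[n --> \oo] --> mean p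
    & (mean p < +oo)%E].

Definition alpha_seq p a r : Prop :=
  [/\ 0 < a < 1,
      forall j, (1 <= j)%N -> 0 <= r j <= 1
    & expect p r = a%:E].

Definition stoch_le p r' r : Prop :=
  forall K, (1 <= K)%N ->
    (\sum_(K <= j <oo) (p j * r' j)%:E <= \sum_(K <= j <oo) (p j * r j)%:E)%E.

Definition EDr p r : R := fine (expect p (fun j => j%:R * r j)).

(* sum_i (1 - r_i) p_i s^i; it may diverge for s > 1. *)
Definition kept_pgf p r (s : R) : R :=
  fine (expect p (fun i => (1 - r i) * s ^+ i)).

Definition beta p a r : R := EDr p r + 1 - a.

Definition gfun p a r (s : R) : R :=
  (beta p a r)^-1 * (kept_pgf p r s + EDr p r * s).

(* g' on (0,1], taken as the left derivative: this is the derivative at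
   every s in (0,1), and at s = 1, the end of the domain of g, it is the only
   derivative available. *)
Definition gfun' p a r (s : R) : R :=
  lim ((gfun p a r t - gfun p a r s) / (t - s) @[t --> s^'-]).

Definition eta_solution p a r (s : R) : Prop :=
  0 < s <= 1 /\ gfun' p a r s = fine (mean p) / beta p a r * s.

(* The smallest solution; the default value 1 is never used for an
   alpha-sequence, because 1 is a solution and a smallest one exists. *)
Definition eta p a r : R :=
  xget 1 [set s | eta_solution p a r s /\
                  forall t, eta_solution p a r t -> s <= t].

(* The term 2 E[D r_D] eta is part of the source definition; the limiting
   proportion of vertices in the giant component is the same expression
   without it. *)
Definition rho p a r : R :=
  1 - a - 2 * EDr p r * eta p a r - kept_pgf p r (eta p a r).

Definition edges p a r : R :=
  fine (mean p) / 2 * (1 - eta p a r ^+ 2) - EDr p r * (1 - eta p a r).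

(* For 0 < a < 1 each quantile exists, is unique and is at least 1, so the
   default value 0 is never used. *)
Definition top_quantile p a : nat :=
  xget 0%N [set k | (prob p (fun j => (k < j)%N) < a%:E)%E /\
                    (a%:E <= prob p (fun j => (k <= j)%N))%E].

Definition bottom_quantile p a : nat :=
  xget 0%N [set l | (prob p (fun j => (j < l)%N) < a%:E)%E /\
                    (a%:E <= prob p (fun j => (j <= l)%N))%E].

Definition top_removal p a (i : nat) : R :=
  let k := top_quantile p a in
  if (i < k)%N then 0
  else if (k < i)%N then 1
  else (a - fine (prob p (fun j => (k < j)%N))) / p k.

Definition bottom_removal p a (i : nat) : R :=
  let l := bottom_quantile p a in
  if (i < l)%N then 1
  else if (l < i)%N then 0
  else (a - fine (prob p (fun j => (j < l)%N))) / p l.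

Definition alpha_c_top p : R :=
  sup [set a : R | 0 < a < 1 /\
    let k := top_quantile p a in
    (mean p + (k * k.-1)%N%:R%:E * (a%:E - prob p (fun j => (k < j)%N))
       < expect p (fun j => (j * j.-1)%N%:R * (j <= k)%N%:R)%R)%E].

Definition alpha_c_bottom p : R :=
  sup [set a : R | 0 < a < 1 /\
    let l := bottom_quantile p a in
    (mean p + (l * l.-1)%N%:R%:E * (a%:E - prob p (fun j => (j < l)%N))
       < expect p (fun j => (j * j.-1)%N%:R * (l <= j)%N%:R)%R)%E].

End DegreeDistribution.

(* Main.v *)
Require Import Defs.
From HB Require Import structures.
From mathcomp Require Import all_boot all_order all_algebra.
From mathcomp Require Import all_classical all_reals all_analysis.
From mathcomp Require Import ring lra.

Set Implicit Arguments.
Unset Strict Implicit.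
Unset Printing Implicit Defensive.

Import Order.TTheory GRing.Theory Num.Theory.
Import numFieldNormedType.Exports.

Local Open Scope classical_set_scope.
Local Open Scope ring_scope.

(** Write c(r) = E[D r_D], F_r(s) = E[(1 - r_D) s^D] and m = E[D].  Then
    beta g_r'(s) = E[D (r_D + (1 - r_D) s^(D-1))] =: G_r(s), so eta_r is the
    smallest solution in (0,1] of G_r(s) = m s.  As G_r is nondecreasing,
    bounded by m and bounded below by c(r) > 0, this smallest solution is the
    least prefixed point of s |-> G_r(s) / m: eta_r <= t as soon as
    G_r(t) <= m t ([eta_spec], the Knaster-Tarski argument).

    Everything monotone in the theorem comes from one relation, [lighter r' r]:
    E[h(D) r'_D] <= E[h(D) r_D] for every nondecreasing h of at most linear
    growth.  Taking h(j) = j, h(j) = j (1 - s^(j-1)) and h(j) = - s^j it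
    compares c, G and F, hence eta, and the order of rho and of e follows by
    elementary algebra ([lighter_giant]).  The relation holds between r' and r
    in stochastic order by summation by parts on truncations of h
    ([stoch_le_lighter]); it makes the top removal the heaviest and the
    bottom removal the lightest sequence of mass alpha, because each of them
    is extreme on either side of its quantile k, whence (h(j) - h(k)) times
    the difference with any other sequence has a constant sign
    ([crossing_le]).

    For the critical values, let w(j) = j (j - 1) and let T(a), B(a) be
    E[w(D) (1 - r_D)] for the top and the bottom removal of mass a; these
    critical values are the suprema of the a with T(a) > m, respectively B(a) > m.  The sign
    argument also applies to w and gives T(a) <= (1 - a) E[w(D)] <= B(a),
    the left inequality being strict unless D is constant.  The middle term is
    the value for uniform removal, whose threshold a* = 1 - 1 / nu therefore
    does not exceed the bottom critical value.  Since T is below m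
    at a* and Lipschitz away from 0 ([kept_ff_top_le]), T is at most m already
    slightly below a*, so the top critical value is smaller than a*.  When E[w(D)] is
    infinite the same argument runs with a* = 1, as B is infinite and T(a)
    tends to 0 when a tends to 1. *)

(** * Real-valued expectations as convergent series *)

Section RealExpectation.
Variables (R : realType) (p : nat -> R).
Hypothesis p_ge0 : forall j, (1 <= j)%N -> 0 <= p j.
Implicit Types (f g : nat -> R) (c : R).

Definition psum f (n : nat) : R := \sum_(1 <= j < n) p j * f j.

Definition Ex_integrable f : Prop := cvgn (psum (fun j => `|f j|)).

Definition Ex f : R := limn (psum f).

Lemma psumD f g n : psum (fun j => f j + g j) n = psum f n + psum g n.
Proof. by rewrite -big_split; apply: eq_bigr => j _; rewrite mulrDr. Qed.

Lemma psumZ c f n : psum (fun j => c * f j) n = c * psum f n.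
Proof. by rewrite mulr_sumr; apply: eq_bigr => j _; rewrite mulrCA. Qed.

Lemma psum_nondecreasing f : (forall j, (1 <= j)%N -> 0 <= f j) ->
  nondecreasing_seq (psum f).
Proof.
move=> f0; apply/nondecreasing_seqP => -[|n].
  by rewrite /psum !big_geq.
by rewrite /psum [leRHS]big_nat_recr//= lerDl mulr_ge0 ?p_ge0 ?f0.
Qed.

Lemma le_psum f g n : (forall j, (1 <= j)%N -> f j <= g j) ->
  psum f n <= psum g n.
Proof.
move=> fg; apply: ler_sum_nat => j /andP[j1 _].
by rewrite ler_wpM2l ?p_ge0 ?fg.
Qed.

Lemma cvg_psum_ge0 f g : (forall j, (1 <= j)%N -> 0 <= f j <= g j) ->
  cvgn (psum g) -> cvgn (psum f).
Proof.
move=> fg cg.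
have f0 j : (1 <= j)%N -> 0 <= f j by move=> /fg/andP[].
have g0 j : (1 <= j)%N -> 0 <= g j by move=> /fg/andP[/le_trans]; apply.
apply: nondecreasing_is_cvgn; first exact: psum_nondecreasing.
exists (limn (psum g)) => _ [n _ <-].
apply: le_trans (nondecreasing_cvgn_le (psum_nondecreasing g0) cg n).
by apply: le_psum => j /fg/andP[].
Qed.

Lemma Ex_integrable_le f g : (forall j, (1 <= j)%N -> `|f j| <= g j) ->
  Ex_integrable g -> Ex_integrable f.
Proof.
move=> fg; apply: cvg_psum_ge0 => j j1.
by rewrite normr_ge0 (le_trans (fg _ j1)) ?ler_norm.
Qed.

Lemma Ex_integrableZ c f : Ex_integrable f -> Ex_integrable (fun j => c * f j).
Proof.
move=> cf; rewrite /Ex_integrable.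
rewrite (_ : psum _ = fun n => `|c| * psum (fun j => `|f j|) n).
  exact: is_cvgMr.
by apply/funext => n; rewrite -psumZ; congr psum; apply/funext => j; rewrite normrM.
Qed.

Lemma Ex_integrableD f g : Ex_integrable f -> Ex_integrable g ->
  Ex_integrable (fun j => f j + g j).
Proof.
move=> cf cg.
apply: (@cvg_psum_ge0 _ (fun j => `|f j| + `|g j|)).
  by move=> j _; rewrite normr_ge0 ler_normD.
rewrite (_ : psum _ = fun n => psum (fun j => `|f j|) n + psum (fun j => `|g j|) n).
  exact: is_cvgD.
by apply/funext => n; rewrite -psumD.
Qed.

Lemma Ex_integrableB f g : Ex_integrable f -> Ex_integrable g ->
  Ex_integrable (fun j => f j - g j).
Proof.
move=> cf /(@Ex_integrableZ (-1)) cg.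
by under eq_fun do rewrite -mulN1r; exact: Ex_integrableD.
Qed.

(** [f = (f + |f|) - |f|] is a difference of two nonnegative functions, whose
    partial sums are monotone. *)
Lemma is_cvg_psum f : Ex_integrable f -> cvgn (psum f).
Proof.
move=> cf.
rewrite (_ : psum f =
  fun n => psum (fun j => f j + `|f j|) n - psum (fun j => `|f j|) n).
  apply: is_cvgB => //.
  apply: (@cvg_psum_ge0 _ (fun j => 2 * `|f j|)).
    move=> j _; have := ler_norm (f j); have := ler_norm (- f j).
    rewrite normrN; lra.
  rewrite (_ : psum _ = fun n => 2 * psum (fun j => `|f j|) n).
    exact: is_cvgMr.
  by apply/funext => n; rewrite psumZ.
by apply/funext => n; rewrite psumD addrK.
Qed.

Lemma cvg_psum f : Ex_integrable f -> psum f @ \oo --> Ex f.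
Proof. by move=> /is_cvg_psum. Qed.

Lemma ExD f g : Ex_integrable f -> Ex_integrable g ->
  Ex (fun j => f j + g j) = Ex f + Ex g.
Proof.
move=> cf cg; apply: cvg_lim => //.
rewrite (_ : psum _ = fun n => psum f n + psum g n).
  by apply: cvgD; exact: cvg_psum.
by apply/funext => n; rewrite psumD.
Qed.

Lemma ExZ c f : Ex_integrable f -> Ex (fun j => c * f j) = c * Ex f.
Proof.
move=> cf; apply: cvg_lim => //.
rewrite (_ : psum _ = fun n => c * psum f n).
  by apply: cvgMr; exact: cvg_psum.
by apply/funext => n; rewrite psumZ.
Qed.

Lemma ExB f g : Ex_integrable f -> Ex_integrable g ->
  Ex (fun j => f j - g j) = Ex f - Ex g.
Proof.
move=> cf cg; under eq_fun do rewrite -mulN1r.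
by rewrite ExD ?ExZ ?mulN1r//; exact: Ex_integrableZ.
Qed.

Lemma le_Ex f g : Ex_integrable f -> Ex_integrable g ->
  (forall j, (1 <= j)%N -> f j <= g j) -> Ex f <= Ex g.
Proof.
move=> cf cg fg; apply: ler_lim; [exact: is_cvg_psum|exact: is_cvg_psum|].
by apply: nearW => n; exact: le_psum.
Qed.

Lemma psum_le_Ex f n : Ex_integrable f -> (forall j, (1 <= j)%N -> 0 <= f j) ->
  psum f n <= Ex f.
Proof.
move=> cf f0; apply: nondecreasing_cvgn_le; last exact: is_cvg_psum.
exact: psum_nondecreasing.
Qed.

Lemma psum_pos f k : (forall j, (1 <= j)%N -> 0 <= f j) -> (1 <= k)%N ->
  p k * f k <= psum f k.+1.
Proof.
move=> f0 k1; rewrite /psum big_nat_recr//= lerDr.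
rewrite big_nat_cond sumr_ge0// => j; rewrite andbT => /andP[j1 _].
by rewrite mulr_ge0 ?p_ge0 ?f0.
Qed.

Lemma Ex_ge0 f : Ex_integrable f -> (forall j, (1 <= j)%N -> 0 <= f j) -> 0 <= Ex f.
Proof.
by move=> cf f0; apply: le_trans (psum_le_Ex 0 cf f0); rewrite /psum big_geq.
Qed.

Lemma lt_Ex f g k : Ex_integrable f -> Ex_integrable g ->
  (forall j, (1 <= j)%N -> f j <= g j) ->
  (1 <= k)%N -> 0 < p k -> f k < g k -> Ex f < Ex g.
Proof.
move=> cf cg fg k1 pk fgk; rewrite -subr_gt0 -ExB//.
have gf0 j : (1 <= j)%N -> 0 <= g j - f j by move=> /fg; rewrite subr_ge0.
apply: lt_le_trans (psum_le_Ex k.+1 (Ex_integrableB cg cf) gf0).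
by apply: lt_le_trans (psum_pos gf0 k1); rewrite mulr_gt0// subr_gt0.
Qed.

Lemma eq_Ex f g : (forall j, (1 <= j)%N -> f j = g j) -> Ex f = Ex g.
Proof.
move=> fg; congr (lim (_ @ \oo)); apply/funext => n.
by apply: eq_big_nat => j /andP[/fg ->].
Qed.

Lemma psum_stationary f N : (forall j, (N <= j)%N -> f j = 0) ->
  psum f @ \oo --> psum f N.
Proof.
move=> fN; apply: cvg_near_cst; near=> n.
have Nn : (N <= n)%N by near: n; exact: nbhs_infty_ge.
case: (leqP 1 N) => [N1|]; last first.
  rewrite ltnS leqn0 => /eqP N0; rewrite /psum [RHS]big_geq ?N0// big1//= => j _.
  by rewrite fN ?N0// mulr0.
rewrite /psum (@big_cat_nat _ _ _ N)//= [X in _ + X]big_nat_cond.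
rewrite [X in _ + X]big1 ?addr0// => j.
by rewrite andbT => /andP[/fN -> _]; rewrite mulr0.
Unshelve. all: by end_near. Qed.

Lemma Ex_integrable_support f N : (forall j, (N <= j)%N -> f j = 0) -> Ex_integrable f.
Proof.
move=> fN; apply/cvg_ex; exists (psum (fun j => `|f j|) N).
by apply: psum_stationary => j /fN ->; rewrite normr0.
Qed.

Lemma Ex_support f N : (forall j, (N <= j)%N -> f j = 0) -> Ex f = psum f N.
Proof. by move=> fN; apply: cvg_lim => //; exact: psum_stationary. Qed.

Lemma Ex_eq k c : (1 <= k)%N -> Ex (fun j => c * (j == k)%:R) = p k * c.
Proof.
move=> k1; rewrite (@Ex_support _ k.+1); last first.
  by move=> j kj; rewrite gtn_eqF// mulr0.
rewrite /psum big_nat_recr//= eqxx mulr1 big_nat_cond big1 ?add0r// => j.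
by rewrite andbT => /andP[_ jk]; rewrite ltn_eqF// !mulr0.
Qed.

Lemma expectE f : Ex_integrable f -> expect p f = (Ex f)%:E.
Proof.
move=> /cvg_psum cf; apply: cvg_lim => //.
rewrite (_ : (fun n => _) = EFin \o psum f); last first.
  by apply/funext => n /=; rewrite sumEFin.
by apply: cvg_EFin => //; apply: nearW.
Qed.

Lemma expect_lty f : (forall j, (1 <= j)%N -> 0 <= f j) ->
  (expect p f < +oo)%E -> Ex_integrable f.
Proof.
move=> f0 fy.
have e0 : (0 <= expect p f)%E.
  by apply: nneseries_ge0 => j j1 _; rewrite lee_fin mulr_ge0 ?p_ge0 ?f0.
apply: (@cvg_psum_ge0 _ f) => [j j1|].
  by rewrite normr_ge0 ger0_norm ?f0 ?lexx.
apply: nondecreasing_is_cvgn; first exact: psum_nondecreasing.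
exists (fine (expect p f)) => _ [n _ <-].
rewrite -lee_fin fineK ?ge0_fin_numE// /psum -sumEFin.
by apply: nneseries_lim_ge => j j1 _; rewrite lee_fin mulr_ge0 ?p_ge0 ?f0.
Qed.

(** With [expect_lty], the dichotomy that handles an infinite E[D(D-1)]. *)
Lemma expect_pinfty f : (forall j, (1 <= j)%N -> 0 <= f j) ->
  ~ Ex_integrable f -> expect p f = +oo%E.
Proof.
move=> f0 fN; apply/eqP; rewrite -leye_eq leNgt; apply/negP.
by move=> /(expect_lty f0).
Qed.

(** The tail of the series for [f] beyond [N] is the expectation of
    [1{N <= D} f(D)], which the one for [g] bounds. *)
Lemma Ex_tail f g N : (forall j, (1 <= j)%N -> `|f j| <= g j) -> Ex_integrable g ->
  `|Ex f - psum f N| <= Ex g - psum g N.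
Proof.
move=> fg cg; have cf := Ex_integrable_le fg cg.
have tailE h : Ex_integrable h ->
    Ex_integrable (fun j => (N <= j)%:R * h j) /\
    Ex h - psum h N = Ex (fun j => (N <= j)%:R * h j).
  move=> ch.
  have c1 : Ex_integrable (fun j => (N <= j)%:R * h j).
    apply: (@Ex_integrable_le _ (fun j => `|h j|)).
      by move=> j _; case: leq; rewrite ?mul1r// mul0r normr0.
    by apply: cvg_psum_ge0 ch => j _; rewrite normr_id normr_ge0 lexx.
  have fin j : (N <= j)%N -> (j < N)%:R * h j = 0.
    by move=> Nj; rewrite ltnNge Nj mul0r.
  split=> //.
  have -> : psum h N = Ex (fun j => (j < N)%:R * h j).
    rewrite (Ex_support fin); apply: eq_big_nat => j /andP[_ ->].
    by rewrite mul1r.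
  rewrite -ExB//; last exact: Ex_integrable_support fin.
  apply: eq_Ex => j _; case: ltnP => _; rewrite !(mul1r,mul0r) ?subrr ?subr0//.
have [cf' ->] := tailE _ cf; have [cg' ->] := tailE _ cg.
rewrite ler_norml -mulN1r -ExZ// !le_Ex//; last 2 first.
- exact: Ex_integrableZ.
- move=> j /fg; rewrite ler_norml => /andP[+ _].
  by case: leq; rewrite ?mul1r ?mul0r ?mulr0// mulN1r.
move=> j /fg; rewrite ler_norml => /andP[_].
by case: leq; rewrite ?mul1r ?mul0r.
Qed.

(** Dominated convergence along any filter.  It serves the left limit defining
    [g'], the truncations of a test function and the tails P(D > n). *)
Lemma dominated_Ex (T : Type) (F : set_system T) (FF : Filter F)
    (f : T -> nat -> R) (l g : nat -> R) :
  (forall j, (1 <= j)%N -> f t j @[t --> F] --> l j) ->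
  (\forall t \near F, forall j, (1 <= j)%N -> `|f t j| <= g j) ->
  (forall j, (1 <= j)%N -> `|l j| <= g j) -> Ex_integrable g ->
  Ex (f t) @[t --> F] --> Ex l.
Proof.
move=> fl fg lg cg; apply/cvgrPdist_le => e e0.
have e3 : 0 < e / 3 by rewrite divr_gt0.
have /cvgrPdist_le/(_ _ e3)[N _ /(_ N)/= /(_ (leqnn _)) tailN] := cvg_psum cg.
have cN : psum (f t) N @[t --> F] --> psum l N.
  rewrite /psum big_nat_cond; under eq_fun do rewrite big_nat_cond.
  apply: cvg_big => [|j]; first exact: add_continuous.
  rewrite andbT => /andP[/fl cj _].
  exact: cvgMr.
have /cvgrPdist_le/(_ _ e3) nearN := cN.
near=> t.
have ft : forall j, (1 <= j)%N -> `|f t j| <= g j by near: t.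
have Nt : `|psum l N - psum (f t) N| <= e / 3 by near: t.
have := Ex_tail N ft cg; have := Ex_tail N lg cg.
move: Nt tailN; rewrite !ler_norml => /andP[? ?] /andP[? ?] /andP[? ?] /andP[? ?].
by apply/andP; split; lra.
Unshelve. all: by end_near. Qed.

End RealExpectation.

(** * The fixed-point equation for eta *)

Section Removal.
Variables (R : realType) (p : nat -> R).
Hypotheses (p_pmf : is_pmf p) (mean_lty : (mean p < +oo)%E).
Implicit Types (r f h : nat -> R) (a s t C : R).

Let p_ge0 : forall j, (1 <= j)%N -> 0 <= p j := p_pmf.1.

Definition fraction r : Prop := forall j, (1 <= j)%N -> 0 <= r j <= 1.

Lemma Ex_integrable_id : Ex_integrable p (fun j => j%:R).
Proof. by apply: expect_lty => // j _; rewrite ler0n. Qed.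

Lemma Ex_integrable_linear f C : (forall j, (1 <= j)%N -> `|f j| <= C * j%:R) ->
  Ex_integrable p f.
Proof.
move=> fC; apply: (Ex_integrable_le p_ge0 fC).
by apply: Ex_integrableZ; exact: Ex_integrable_id.
Qed.

Lemma Ex_integrable_bounded f C : (forall j, (1 <= j)%N -> `|f j| <= C) ->
  Ex_integrable p f.
Proof.
move=> fC; apply: (@Ex_integrable_linear _ C) => j j1.
apply: le_trans (fC j j1) _; apply: ler_peMr; last by rewrite ler1n.
exact: le_trans (fC j j1).
Qed.

Lemma Ex_integrable_cst C : Ex_integrable p (fun=> C).
Proof. exact: (@Ex_integrable_bounded _ `|C|). Qed.

Lemma fraction_norm r j : fraction r -> (1 <= j)%N -> `|r j| <= 1.
Proof. by move=> fr j1; have /andP[r0 r1] := fr j j1; rewrite ger0_norm. Qed.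

Lemma Ex_integrable_fraction r : fraction r -> Ex_integrable p r.
Proof. by move=> fr; apply: (@Ex_integrable_bounded _ 1) => j; exact: fraction_norm. Qed.

Lemma Ex_integrable_Mfraction h r C : fraction r ->
  (forall j, (1 <= j)%N -> `|h j| <= C * j%:R) ->
  Ex_integrable p (fun j => h j * r j).
Proof.
move=> fr hC; apply: (@Ex_integrable_linear _ C) => j j1.
rewrite normrM (le_trans _ (hC j j1))// ler_piMr//; exact: fraction_norm.
Qed.

Lemma meanE : mean p = (Ex p (fun j => j%:R))%:E.
Proof. by apply: expectE => //; exact: Ex_integrable_id. Qed.

Lemma Ex1 : Ex p (fun=> 1) = 1.
Proof.
apply: EFin_inj; rewrite -expectE//; last first.
  exact: Ex_integrable_cst.
by rewrite /expect; under eq_eseriesr do rewrite mulr1; exact: p_pmf.2.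
Qed.

Lemma EDrE r : fraction r -> EDr p r = Ex p (fun j => j%:R * r j).
Proof.
move=> fr; rewrite /EDr expectE//; apply: (@Ex_integrable_Mfraction _ _ 1) => // j _.
by rewrite mul1r normr_nat.
Qed.

Lemma alpha_seqE a r : alpha_seq p a r ->
  [/\ 0 < a, a < 1, fraction r & Ex p r = a].
Proof.
move=> [/andP[a0 a1] fr Er]; split=> //.
by apply: EFin_inj; rewrite -expectE//; exact: Ex_integrable_fraction.
Qed.

Lemma Ex_integrable_kept r s : fraction r -> 0 <= s <= 1 ->
  Ex_integrable p (fun j => (1 - r j) * s ^+ j).
Proof.
move=> fr /andP[s0 s1]; apply: (@Ex_integrable_bounded _ 1) => j j1.
have /andP[r0 r1] := fr j j1.
rewrite ger0_norm; last by rewrite mulr_ge0 ?exprn_ge0 ?subr_ge0.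
by rewrite mulr_ile1 ?exprn_ge0 ?subr_ge0 ?exprn_ile1// gerBl.
Qed.

Lemma kept_pgfE r s : fraction r -> 0 <= s <= 1 ->
  kept_pgf p r s = Ex p (fun j => (1 - r j) * s ^+ j).
Proof. by move=> fr s01; rewrite /kept_pgf expectE//; exact: Ex_integrable_kept. Qed.

(** [beta * g'(s)], with the linear term of [g] put under the expectation. *)
Definition slope r s : R :=
  Ex p (fun j => j%:R * (r j + (1 - r j) * s ^+ j.-1)).

Lemma slope_term r s j : fraction r -> 0 <= s <= 1 -> (1 <= j)%N ->
  0 <= j%:R * (r j + (1 - r j) * s ^+ j.-1) <= 1 * j%:R.
Proof.
move=> fr /andP[s0 s1] /fr/andP[r0 r1].
have x0 : 0 <= s ^+ j.-1 by rewrite exprn_ge0.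
have x1 : s ^+ j.-1 <= 1 by rewrite exprn_ile1.
rewrite mulr_ge0//=; last by rewrite addr_ge0// mulr_ge0// subr_ge0.
rewrite mulrC ler_wpM2r//.
have : (1 - r j) * s ^+ j.-1 <= (1 - r j) * 1 by rewrite ler_wpM2l// subr_ge0.
lra.
Qed.

Lemma Ex_integrable_slope r s : fraction r -> 0 <= s <= 1 ->
  Ex_integrable p (fun j => j%:R * (r j + (1 - r j) * s ^+ j.-1)).
Proof.
move=> fr s01; apply: (@Ex_integrable_linear _ 1) => j j1.
by have /andP[x0 x1] := slope_term fr s01 j1; rewrite ger0_norm.
Qed.

Lemma slope_monotone r s t : fraction r -> 0 <= s -> s <= t -> t <= 1 ->
  slope r s <= slope r t.
Proof.
move=> fr s0 st t1; have t0 := le_trans s0 st; have s1 := le_trans st t1.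
apply: le_Ex => //; first by apply: Ex_integrable_slope => //; rewrite s0.
  by apply: Ex_integrable_slope => //; rewrite t0.
move=> j j1; have /andP[_ r1] := fr j j1.
by rewrite ler_wpM2l// lerD2l ler_wpM2l ?subr_ge0// lerXn2r.
Qed.

Lemma EDr_ge r a : alpha_seq p a r -> a <= EDr p r.
Proof.
move=> /alpha_seqE[_ _ fr <-]; rewrite EDrE//.
apply: le_Ex => //; first exact: Ex_integrable_fraction.
  by apply: (@Ex_integrable_Mfraction _ _ 1) => // j _; rewrite mul1r normr_nat.
by move=> j j1; have /andP[r0 _] := fr j j1; rewrite ler_peMl// ler1n.
Qed.

Lemma EDr_le_slope r s : fraction r -> 0 <= s <= 1 -> EDr p r <= slope r s.
Proof.
move=> fr s01; rewrite EDrE//; apply: le_Ex => //.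
- by apply: (@Ex_integrable_Mfraction _ _ 1) => // j _; rewrite mul1r normr_nat.
- exact: Ex_integrable_slope.
- move=> j j1; have /andP[r0 r1] := fr j j1; have /andP[s0 _] := s01.
  by rewrite ler_wpM2l// lerDl mulr_ge0 ?subr_ge0 ?exprn_ge0.
Qed.

Lemma slope1 r : slope r 1 = Ex p (fun j => j%:R).
Proof. by apply: eq_Ex => j _; rewrite expr1n mulr1 subrKC mulr1. Qed.

(** The part at degree [j] of the difference quotient of [beta * g] between [s]
    and [t], with the division by [t - s] carried out, so that it is also
    meaningful at [t = s]. *)
Definition secant r s t (j : nat) : R :=
  j%:R * r j + (1 - r j) * \sum_(i < j) t ^+ (j.-1 - i) * s ^+ i.

Lemma secantE r s t j :
  (t - s) * (secant r s t j - j%:R * r j) = (1 - r j) * t ^+ j - (1 - r j) * s ^+ j.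
Proof. by rewrite /secant [X in _ * X]addrC addKr mulrCA -subrXX mulrBr. Qed.

Lemma secant_diag r s j : (1 <= j)%N ->
  secant r s s j = j%:R * (r j + (1 - r j) * s ^+ j.-1).
Proof.
move=> j1; rewrite /secant mulrDr; congr (_ + _).
rewrite (eq_bigr (fun=> s ^+ j.-1)); last first.
  by move=> i _; rewrite -exprD subnK// -ltnS prednK.
by rewrite sumr_const card_ord -[in LHS]mulr_natl mulrCA.
Qed.

Lemma secant_bound r s t j : fraction r -> 0 <= s <= 1 -> 0 <= t <= 1 ->
  (1 <= j)%N -> `|secant r s t j| <= 2 * j%:R.
Proof.
move=> fr /andP[s0 s1] /andP[t0 t1] /fr/andP[r0 r1].
have x0 : 0 <= \sum_(i < j) t ^+ (j.-1 - i) * s ^+ i.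
  by apply: sumr_ge0 => i _; rewrite mulr_ge0 ?exprn_ge0.
have x1 : \sum_(i < j) t ^+ (j.-1 - i) * s ^+ i <= j%:R.
  rewrite -[X in _ <= X%:R]card_ord -sumr_const; apply: ler_sum => i _.
  by rewrite mulr_ile1 ?exprn_ge0 ?exprn_ile1.
have n0 : 0 <= j%:R :> R by [].
rewrite /secant ger0_norm; last by rewrite addr_ge0 ?mulr_ge0// subr_ge0.
have : j%:R * r j <= j%:R * 1 by rewrite ler_wpM2l.
have : (1 - r j) * \sum_(i < j) t ^+ (j.-1 - i) * s ^+ i <= 1 * j%:R.
  by rewrite ler_pM// ?subr_ge0// gerBl.
lra.
Qed.

(** At degree [j] the secant is at most [2 j], and E[D] is finite. *)
Lemma cvg_secant r s : fraction r -> 0 < s <= 1 ->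
  Ex p (secant r s t) @[t --> s^'-] --> slope r s.
Proof.
move=> fr /andP[s0 s1]; have s01 : 0 <= s <= 1 by rewrite ltW.
rewrite (_ : slope r s = Ex p (secant r s s)); last first.
  by apply: eq_Ex => j /secant_diag ->.
apply: (@dominated_Ex _ _ p_ge0 _ _ _ _ _ (fun j => 2 * j%:R)).
- move=> j j1; apply: cvgD; first exact: cvg_cst.
  apply: cvgMr; apply: cvg_big => [|i _]; first exact: add_continuous.
  apply: cvgMl; apply: cvg_at_left_filter; exact: exprn_continuous.
- near=> t => j j1; apply: secant_bound => //; apply/andP; split.
    by near: t; exact: nbhs_left_ge.
  by rewrite (le_trans _ s1)//; near: t; exact: nbhs_left_le.
- by move=> j; exact: secant_bound.
- by apply: Ex_integrableZ; exact: Ex_integrable_id.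
Unshelve. all: by end_near. Qed.

Lemma gfun'E a r s : fraction r -> 0 < s <= 1 ->
  gfun' p a r s = (beta p a r)^-1 * slope r s.
Proof.
move=> fr /andP[s0 s1]; apply: cvg_lim => //.
have s01 : 0 < s <= 1 by rewrite s0.
have s01' : 0 <= s <= 1 by rewrite ltW.
apply: cvg_trans (cvgMr (cvg_secant fr s01)).
apply: near_eq_cvg; near=> t.
have ts : t < s by near: t; exact: nbhs_left_lt.
have t0 : 0 < t by near: t; exact: nbhs_left_gt.
have t01 : 0 <= t <= 1 by rewrite ltW//= (le_trans (ltW ts)).
rewrite /gfun !kept_pgfE// -mulrBr -mulrA; congr (_ * _).
have ts0 : t - s != 0 by rewrite subr_eq0 lt_eqF.
apply: (mulIf ts0); rewrite mulfVK//.
have -> : forall A B C : R, A + C * t - (B + C * s) = (A - B) + C * (t - s).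
  by move=> A B C; ring.
have cr : Ex_integrable p (fun j => j%:R * r j).
  by apply: (@Ex_integrable_Mfraction _ _ 1) => // j _; rewrite mul1r normr_nat.
have cs : Ex_integrable p (secant r s t).
  by apply: (@Ex_integrable_linear _ 2) => j; exact: secant_bound.
rewrite EDrE// -(ExB p_ge0 (Ex_integrable_kept fr t01) (Ex_integrable_kept fr s01')).
under [X in _ = X + _]eq_Ex do rewrite -secantE.
by rewrite ExZ ?ExB//; [ring|exact: Ex_integrableB].
Unshelve. all: by end_near. Qed.

(** Knaster-Tarski: the infimum of the [s] with [slope r s <= m s] belongs to
    that set because [slope r] is nondecreasing, and it solves the equation
    because [slope r s / m] belongs to the set whenever [s] does.  It is not 0
    since [slope r >= E[D r_D] >= a > 0].  The last clause, stronger than being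
    the smallest solution, is what makes [eta] monotone in [slope]. *)
Lemma eta_spec a r : alpha_seq p a r ->
  let s := Defs.eta p a r in
  [/\ 0 < s <= 1, slope r s = Ex p (fun j => j%:R) * s &
      forall t, 0 <= t <= 1 -> slope r t <= Ex p (fun j => j%:R) * t -> s <= t].
Proof.
move=> ar; have [a0 a1 fr _] := alpha_seqE ar.
set m := Ex p _.
have c0 : 0 < EDr p r by rewrite (lt_le_trans a0)// EDr_ge.
have b0 : 0 < beta p a r by rewrite /beta; lra.
have m0 : 0 < m by rewrite (lt_le_trans c0)// /m -(slope1 r) EDr_le_slope// ler01 lexx.
have solE s : eta_solution p a r s <-> 0 < s <= 1 /\ slope r s = m * s.
  rewrite /eta_solution meanE/= -/m; split=> -[s01]; rewrite gfun'E//.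
    rewrite -mulrA mulrCA => /mulfI e; split=> //; apply: e.
    by rewrite invr_eq0 gt_eqF.
  by move=> ->; rewrite mulrCA mulrA.
pose S : set R := [set s | 0 <= s <= 1 /\ slope r s <= m * s]; pose s := inf S.
have S1 : S 1 by split; rewrite ?ler01 ?lexx// slope1 mulr1 lexx.
have Slb : has_lbound S by exists 0 => x [/andP[]].
have s0 : 0 <= s by apply: lb_le_inf; [exists 1|move=> x [/andP[]]].
have s1 : s <= 1 by exact: ge_inf.
have s01 : 0 <= s <= 1 by rewrite s0.
have Ss : S s.
  split=> //; rewrite mulrC -ler_pdivrMr//.
  apply: lb_le_inf; [by exists 1|move=> t [/andP[t0 t1] St]].
  rewrite ler_pdivrMr// mulrC (le_trans _ St)//.
  by apply: slope_monotone => //; apply: ge_inf => //; split => //; apply/andP.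
have sgt0 : 0 < s.
  have := lt_le_trans c0 (le_trans (EDr_le_slope fr s01) Ss.2).
  by rewrite pmulr_rgt0.
have sE : slope r s = m * s.
  have q0 : 0 <= slope r s / m.
    by rewrite divr_ge0 ?(ltW m0)// (le_trans (ltW c0))// EDr_le_slope.
  have qs : slope r s / m <= s by rewrite ler_pdivrMr// mulrC Ss.2.
  apply/eqP; rewrite eq_le Ss.2/= mulrC -ler_pdivlMr//.
  apply: ge_inf => //; split; first by rewrite q0 (le_trans qs).
  rewrite [leRHS]mulrC divfK ?gt_eqF//.
  exact: slope_monotone.
have : exists u, eta_solution p a r u /\ forall t, eta_solution p a r t -> u <= t.
  exists s; split; first by apply/solE; rewrite sgt0.
  move=> t /solE[/andP[t0 t1] tE]; apply: ge_inf => //.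
  by split; [rewrite ltW|rewrite tE].
move/(xgetPex 1); rewrite -/(Defs.eta p a r).
case=> /solE[e01 eE] emin; split=> // t t01 tS.
apply: (@le_trans _ _ s).
  by apply: emin; apply/solE; rewrite sgt0.
by apply: ge_inf => //; split.
Qed.

(** * Comparison of removal sequences *)

(** Both factors change sign at the pivot [k]. *)
Lemma crossing_ge0 h k u v :
  (forall i j, (1 <= i)%N -> (i <= j)%N -> h i <= h j) -> (1 <= k)%N ->
  (forall j, (1 <= j)%N -> (j < k)%N -> u j <= v j) ->
  (forall j, (k < j)%N -> v j <= u j) ->
  forall j, (1 <= j)%N -> 0 <= (h j - h k) * (u j - v j).
Proof.
move=> hh k1 uvl uvr j j1; case: (ltngtP j k) => [jk|kj|->]; last first.
- by rewrite subrr mul0r.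
- by rewrite mulr_ge0 ?subr_ge0 ?uvr// hh// ltnW.
- by rewrite mulr_le0 ?subr_le0 ?uvl// hh// ltnW.
Qed.

Lemma crossing_Ex h k u v :
  Ex_integrable p u -> Ex_integrable p v ->
  Ex_integrable p (fun j => h j * u j) -> Ex_integrable p (fun j => h j * v j) ->
  Ex_integrable p (fun j => (h j - h k) * (u j - v j)) /\
  Ex p (fun j => (h j - h k) * (u j - v j)) =
  Ex p (fun j => h j * u j) - Ex p (fun j => h j * v j) - h k * (Ex p u - Ex p v).
Proof.
move=> cu cv chu chv.
have E : (fun j => (h j - h k) * (u j - v j)) =
         (fun j => (h j * u j - h j * v j) - h k * (u j - v j)).
  by apply/funext => j; ring.
have c1 := Ex_integrableB p_ge0 chu chv; have c2 := Ex_integrableB p_ge0 cu cv.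
rewrite E; split; first by apply: Ex_integrableB => //; exact: Ex_integrableZ.
by rewrite ExB ?ExB ?ExZ ?ExB//; exact: Ex_integrableZ.
Qed.

(** A single crossing at [k]: the integrand [(h - h k) (u - v)] is nonnegative.
    The growth of [h] is left free so that [h(j) = j (j - 1)] is covered even if
    it has infinite expectation; [Ex u] and [Ex v] may differ. *)
Lemma crossing_le h k u v :
  (forall i j, (1 <= i)%N -> (i <= j)%N -> h i <= h j) -> (1 <= k)%N ->
  (forall j, (1 <= j)%N -> (j < k)%N -> u j <= v j) ->
  (forall j, (k < j)%N -> v j <= u j) ->
  Ex_integrable p u -> Ex_integrable p v ->
  Ex_integrable p (fun j => h j * u j) -> Ex_integrable p (fun j => h j * v j) ->
  Ex p (fun j => h j * v j) + h k * (Ex p u - Ex p v) <= Ex p (fun j => h j * u j).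
Proof.
move=> hh k1 uvl uvr cu cv chu chv.
have [c E] := crossing_Ex k cu cv chu chv.
have := Ex_ge0 p_ge0 c (crossing_ge0 hh k1 uvl uvr); rewrite E; lra.
Qed.

Lemma crossing_lt h k u v i :
  (forall i j, (1 <= i)%N -> (i <= j)%N -> h i <= h j) -> (1 <= k)%N ->
  (forall j, (1 <= j)%N -> (j < k)%N -> u j <= v j) ->
  (forall j, (k < j)%N -> v j <= u j) ->
  Ex_integrable p u -> Ex_integrable p v ->
  Ex_integrable p (fun j => h j * u j) -> Ex_integrable p (fun j => h j * v j) ->
  (1 <= i)%N -> 0 < p i -> h i != h k -> u i != v i ->
  Ex p (fun j => h j * v j) + h k * (Ex p u - Ex p v) < Ex p (fun j => h j * u j).
Proof.
move=> hh k1 uvl uvr cu cv chu chv i1 pi hi uvi.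
have [c E] := crossing_Ex k cu cv chu chv.
have ge0 := crossing_ge0 hh k1 uvl uvr.
have c0 : Ex_integrable p (fun=> 0) by apply: (@Ex_integrable_support _ _ _ 0).
have E0 : Ex p (fun=> 0) = 0.
  by rewrite (@Ex_support _ _ _ 0)// /psum big_geq.
have gt0 : 0 < (h i - h k) * (u i - v i).
  by rewrite lt_neqAle ge0// andbT eq_sym mulf_neq0// subr_eq0.
have := lt_Ex p_ge0 c0 c ge0 i1 pi gt0; rewrite E E0; lra.
Qed.

(** The bound on the growth of [h] makes both sides converge. *)
Definition lighter r' r : Prop := forall h C,
  (forall i j, (1 <= i)%N -> (i <= j)%N -> h i <= h j) ->
  (forall j, (1 <= j)%N -> `|h j| <= C * j%:R) ->
  Ex p (fun j => h j * r' j) <= Ex p (fun j => h j * r j).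

Lemma crossing_lighter a r' r k : alpha_seq p a r' -> alpha_seq p a r ->
  (1 <= k)%N ->
  (forall j, (1 <= j)%N -> (j < k)%N -> r j <= r' j) ->
  (forall j, (k < j)%N -> r' j <= r j) -> lighter r' r.
Proof.
move=> /alpha_seqE[_ _ fr' Er'] /alpha_seqE[_ _ fr Er] k1 le1 le2 h C hh hC.
have := crossing_le hh k1 le1 le2 (Ex_integrable_fraction fr)
  (Ex_integrable_fraction fr') (Ex_integrable_Mfraction fr hC)
  (Ex_integrable_Mfraction fr' hC).
by rewrite Er Er' subrr mulr0 addr0.
Qed.

Lemma tail_expect r K : fraction r -> (1 <= K)%N ->
  Ex_integrable p (fun j => (K <= j)%:R * r j) /\
  (\sum_(K <= j <oo) (p j * r j)%:E)%E = (Ex p (fun j => (K <= j)%:R * r j))%:E.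
Proof.
move=> fr K1.
have c : Ex_integrable p (fun j => (K <= j)%:R * r j).
  apply: (@Ex_integrable_bounded _ 1) => j j1; rewrite normrM.
  by case: leq; rewrite ?normr1 ?normr0 ?mul1r ?mul0r// fraction_norm.
split=> //; rewrite -expectE//; congr (lim (_ @ \oo)); apply/funext => n.
rewrite (big_nat_widenl _ 1)// big_mkcond; apply: eq_bigr => j _ /=.
by case: leq; rewrite ?mul1r ?mul0r ?mulr0.
Qed.

(** Summation by parts: [h (minn j N.+1)] is [h 1] plus the increments
    [h N.+2 - h N.+1 >= 0] times [1{j >= N.+2}], and the tail order compares the
    latter; then [N] tends to infinity. *)
Lemma stoch_le_lighter a r r' : alpha_seq p a r -> alpha_seq p a r' ->
  stoch_le p r' r -> lighter r' r.
Proof.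
move=> /alpha_seqE[_ _ fr Er] /alpha_seqE[_ _ fr' Er'] rr' h C hh hC.
have minh N j : (1 <= N)%N -> (1 <= j)%N -> `|h (minn j N)| <= C * j%:R.
  move=> N1 j1; have m1 : (1 <= minn j N)%N by rewrite leq_min j1.
  have C0 : 0 <= C by have := hC 1%N isT; rewrite mulr1; exact: le_trans.
  by rewrite (le_trans (hC _ m1))// ler_wpM2l// ler_nat geq_minl.
have trunc N : Ex p (fun j => h (minn j N.+1) * r' j) <=
               Ex p (fun j => h (minn j N.+1) * r j).
  elim: N => [|N IH].
    have E1 x : fraction x -> Ex p (fun j => h (minn j 1) * x j) = h 1%N * Ex p x.
      move=> fx; rewrite -ExZ//; last exact: Ex_integrable_fraction.
      by apply: eq_Ex => j /minn_idPr ->.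
    by rewrite !E1// Er Er'.
  have ES x : fraction x -> Ex p (fun j => h (minn j N.+2) * x j) =
      Ex p (fun j => h (minn j N.+1) * x j) +
      (h N.+2 - h N.+1) * Ex p (fun j => (N.+2 <= j)%:R * x j).
    move=> fx; have [cx _] := @tail_expect x N.+2 fx isT.
    rewrite -ExZ// -ExD//; last 2 first.
    - by apply: (@Ex_integrable_Mfraction _ _ C) => // j; exact: minh.
    - exact: Ex_integrableZ.
    apply: eq_Ex => j j1; case: (ltnP N.+1 j) => Nj.
      rewrite (minn_idPr Nj) mul1r; ring.
    by rewrite (minn_idPl (leqW Nj)) mul0r mulr0 addr0.
  rewrite !ES// lerD// ler_wpM2l ?subr_ge0 ?hh// -lee_fin.
  have [_ <-] := @tail_expect r N.+2 fr isT.
  by have [_ <-] := @tail_expect r' N.+2 fr' isT; exact: rr'.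
have cvg x : fraction x ->
    Ex p (fun j => h (minn j N.+1) * x j) @[N --> \oo] --> Ex p (fun j => h j * x j).
  move=> fx; apply: (@dominated_Ex _ _ p_ge0 _ _ _ _ _ (fun j => C * j%:R)).
  - move=> j j1; apply: cvg_near_cst; near=> N.
    have jN : (j <= N)%N by near: N; exact: nbhs_infty_ge.
    by rewrite (minn_idPl (leqW jN)).
  - apply: nearW => N j j1; rewrite normrM.
    rewrite (le_trans _ (minh N.+1 j isT j1))// ler_piMr//; exact: fraction_norm.
  - move=> j j1; rewrite normrM (le_trans _ (hC j j1))// ler_piMr//.
    exact: fraction_norm.
  - by apply: Ex_integrableZ; exact: Ex_integrable_id.
apply: ler_cvg_to (cvg _ fr') (cvg _ fr) _.
by apply: nearW => N; exact: trunc.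
Unshelve. all: by end_near. Qed.

(** [j (r + (1 - r) s^(j-1)) = j s^(j-1) + j (1 - s^(j-1)) r], where the factor of
    [r] is nondecreasing in [j]. *)
Lemma lighter_slope r' r s : fraction r' -> fraction r -> lighter r' r ->
  0 <= s <= 1 -> slope r' s <= slope r s.
Proof.
move=> fr' fr rr' /andP[s0 s1].
pose h (j : nat) := j%:R * (1 - s ^+ j.-1).
have h0 (j : nat) : 0 <= 1 - s ^+ j.-1 by rewrite subr_ge0 exprn_ile1.
have hC j : (1 <= j)%N -> `|h j| <= 1 * j%:R.
  move=> j1; rewrite /h ger0_norm ?mulr_ge0// [leLHS]mulrC ler_wpM2r// gerBl.
  exact: exprn_ge0.
have hh i j : (1 <= i)%N -> (i <= j)%N -> h i <= h j.
  move=> i1 ij; rewrite /h ler_pM ?ler_nat// lerD2l lerN2.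
  by apply: ler_wiXn2l => //; rewrite -!subn1 leq_sub2r.
have cs : Ex_integrable p (fun j => j%:R * s ^+ j.-1).
  apply: (@Ex_integrable_linear _ 1) => j _.
  by rewrite ger0_norm ?mulr_ge0 ?exprn_ge0// [leLHS]mulrC ler_wpM2r// exprn_ile1.
have E x : fraction x ->
    slope x s = Ex p (fun j => j%:R * s ^+ j.-1) + Ex p (fun j => h j * x j).
  move=> fx; rewrite -ExD//; last exact: Ex_integrable_Mfraction fx hC.
  by apply: eq_Ex => j _; rewrite /h; ring.
by rewrite !E// lerD2l; exact: rr' hh hC.
Qed.

Lemma lighter_kept r' r s : fraction r' -> fraction r -> lighter r' r ->
  0 <= s <= 1 -> kept_pgf p r' s <= kept_pgf p r s.
Proof.
move=> fr' fr rr' s01; have /andP[s0 s1] := s01.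
have cs : Ex_integrable p (fun j => s ^+ j).
  by apply: (@Ex_integrable_bounded _ 1) => j _; rewrite ger0_norm ?exprn_ge0// exprn_ile1.
have hC j : (1 <= j)%N -> `|- s ^+ j| <= 1 * j%:R.
  move=> j1; rewrite mul1r normrN ger0_norm ?exprn_ge0//.
  by rewrite (le_trans (exprn_ile1 _ s0 s1))// ler1n.
have hh i j : (1 <= i)%N -> (i <= j)%N -> - s ^+ i <= - s ^+ j.
  by move=> _ ij; rewrite lerN2; exact: ler_wiXn2l.
have E x : fraction x ->
    kept_pgf p x s = Ex p (fun j => s ^+ j) + Ex p (fun j => - s ^+ j * x j).
  move=> fx; rewrite kept_pgfE// -ExD//; last exact: Ex_integrable_Mfraction fx hC.
  by apply: eq_Ex => j _; ring.
by rewrite !E// lerD2l; exact: rr' hh hC.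
Qed.

Lemma kept_pgf_monotone r s t : fraction r -> 0 <= s -> s <= t -> t <= 1 ->
  kept_pgf p r s <= kept_pgf p r t.
Proof.
move=> fr s0 st t1; have t0 := le_trans s0 st; have s1 := le_trans st t1.
have s01 : 0 <= s <= 1 by rewrite s0.
have t01 : 0 <= t <= 1 by rewrite t0.
rewrite !kept_pgfE//; apply: le_Ex; rewrite //; try exact: Ex_integrable_kept.
move=> j j1; have /andP[_ r1] := fr j j1.
by rewrite ler_wpM2l ?subr_ge0// lerXn2r.
Qed.

(** For [edges], at fixed [c] the map [x |-> m/2 (1 - x^2) - c (1 - x)] decreases
    as long as [m x >= c], and [m * eta = slope r eta >= c]. *)
Lemma lighter_giant a r' r : alpha_seq p a r' -> alpha_seq p a r ->
  lighter r' r -> rho p a r <= rho p a r' /\ edges p a r <= edges p a r'.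
Proof.
move=> ar' ar rr'.
have [_ _ fr' _] := alpha_seqE ar'; have [_ _ fr _] := alpha_seqE ar.
have [y01 yE ymin] := eta_spec ar'; have [x01 xE _] := eta_spec ar.
rewrite /rho /edges meanE.
set m := Ex p _ in yE ymin xE *; rewrite [fine m%:E]/=.
move: (Defs.eta p a r') (Defs.eta p a r) => y x in y01 yE ymin x01 xE *.
have /andP[x0 x1] := x01; have /andP[y0 y1] := y01.
have x01' : 0 <= x <= 1 by rewrite ltW.
have y01' : 0 <= y <= 1 by rewrite ltW.
have yx : y <= x by apply: ymin => //; rewrite -xE; exact: lighter_slope.
have cc : EDr p r' <= EDr p r.
  rewrite !EDrE//; apply: (rr' _ 1) => [i j _ ij|j _]; first by rewrite ler_nat.
  by rewrite mul1r normr_nat.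
have a0 := EDr_ge ar'; have ga0 : 0 < a by have /andP[] := let: And3 h _ _ := ar in h.
have kk : kept_pgf p r' y <= kept_pgf p r x.
  apply: le_trans (lighter_kept fr' fr rr' x01').
  by apply: kept_pgf_monotone => //; exact: ltW.
have cy : EDr p r' <= m * y by rewrite -yE EDr_le_slope.
split.
  have : EDr p r' * y <= EDr p r * x by rewrite ler_pM// ltW// (lt_le_trans ga0).
  by rewrite -!mulrA; lra.
rewrite -subr_ge0.
have -> : forall c c' : R, m / 2 * (1 - y ^+ 2) - c' * (1 - y) -
    (m / 2 * (1 - x ^+ 2) - c * (1 - x)) =
  (x - y) * (m * (x + y) / 2 - c') + (c - c') * (1 - x) by move=> c c'; field.
have m0 : 0 <= m by rewrite -(pmulr_lge0 _ y0) (le_trans (ltW ga0))// (le_trans a0).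
have mxy : m * y <= m * x by rewrite ler_wpM2l.
rewrite addr_ge0 ?mulr_ge0 ?subr_ge0//; last by rewrite mulrDr; lra.
Qed.


End Removal.

(** * Quantiles and extremal removals *)

Section Quantiles.
Variables (R : realType) (p : nat -> R).
Hypotheses (p_pmf : is_pmf p) (mean_lty : (mean p < +oo)%E).
Implicit Types (r f h : nat -> R) (a b s t C : R).

Let p_ge0 : forall j, (1 <= j)%N -> 0 <= p j := p_pmf.1.

Lemma Ex_integrable_ind (A : pred nat) : Ex_integrable p (fun j => (A j)%:R).
Proof.
apply: (Ex_integrable_bounded p_pmf mean_lty (C := 1)) => j _.
by case: (A j); rewrite ?normr1 ?normr0.
Qed.

Definition Pr (A : pred nat) : R := Ex p (fun j => (A j)%:R).

Lemma probE (A : pred nat) : prob p A = (Pr A)%:E.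
Proof. by rewrite /prob expectE//; exact: Ex_integrable_ind. Qed.

Lemma PrD1 (A B : pred nat) k : (1 <= k)%N -> ~~ B k ->
  (forall j, A j = (j == k) || B j) -> Pr A = p k + Pr B.
Proof.
move=> k1 Bk AB; rewrite -[p k]mulr1 -(Ex_eq p 1 k1) /Pr.
rewrite -ExD//; [|apply: Ex_integrableZ; exact: Ex_integrable_ind|exact: Ex_integrable_ind].
apply: eq_Ex => j _; rewrite AB mul1r; case: eqP => [->|_] /=.
  by rewrite (negbTE Bk) addr0.
by rewrite add0r.
Qed.

Lemma cvg_Pr_le : Pr (fun j => (j <= n)%N) @[n --> \oo] --> (1 : R).
Proof.
rewrite -(Ex1 p_pmf mean_lty); apply: (@dominated_Ex _ _ p_ge0 _ _ _ _ _ (fun=> 1)).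
- move=> j _; apply: cvg_near_cst; near=> n.
  have -> // : (j <= n)%N by near: n; exact: nbhs_infty_ge.
- by apply: nearW => n j _; case: leq; rewrite ?normr1 ?normr0.
- by move=> j _; rewrite normr1.
- exact: Ex_integrable_cst.
Unshelve. all: by end_near. Qed.

Lemma Pr_gt k : Pr (fun j => (k < j)%N) = 1 - Pr (fun j => (j <= k)%N).
Proof.
rewrite -(Ex1 p_pmf mean_lty) /Pr -ExB//; last exact: Ex_integrable_ind.
  by apply: eq_Ex => j _; case: ltnP; rewrite ?subr0 ?subrr.
exact: Ex_integrable_cst.
Qed.

Lemma Pr_le0 : Pr (fun j => (j <= 0)%N) = 0.
Proof.
rewrite /Pr (@Ex_support _ _ _ 1) ?/psum ?big_geq// => j.
by case: j.
Qed.

Lemma first_level (Q : pred nat) : ~~ Q 0%N -> (\forall n \near \oo, Q n) ->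
  exists2 k, Q k.+1 & ~~ Q k.
Proof.
move=> Q0 [N _ QN].
have ex : exists n, Q n by exists N; exact: (QN N (leqnn N)).
case: (ex_minnP ex) => -[|k] Qk kmin; first by rewrite Qk in Q0.
by exists k => //; apply/negP => /kmin; rewrite ltnn.
Qed.

Lemma bottom_quantileP a : 0 < a < 1 ->
  let l := bottom_quantile p a in
  [/\ (1 <= l)%N, Pr (fun j => (j < l)%N) < a & a <= Pr (fun j => (j <= l)%N)].
Proof.
move=> /andP[a0 a1].
have : exists l, (prob p (fun j => (j < l)%N) < a%:E)%E /\
                 (a%:E <= prob p (fun j => (j <= l)%N))%E.
  have [||k /= k1 k2] := @first_level (fun n => a <= Pr (fun j => (j <= n)%N)).
  - by rewrite Pr_le0 -ltNge.
  - exact: (cvgr_ge _ cvg_Pr_le).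
  - by exists k.+1; rewrite !probE lte_fin lee_fin k1 ltNge k2.
move/(xgetPex 0%N); rewrite -/(bottom_quantile p a) !probE lte_fin lee_fin.
move=> [l1 l2] /=; split=> //; rewrite lt0n; apply/negP => /eqP l0.
by move: l2; rewrite l0 Pr_le0 leNgt a0.
Qed.

Lemma top_quantileP a : 0 < a < 1 ->
  let k := top_quantile p a in
  [/\ (1 <= k)%N, Pr (fun j => (k < j)%N) < a & a <= Pr (fun j => (k <= j)%N)].
Proof.
move=> /andP[a0 a1].
have : exists k, (prob p (fun j => (k < j)%N) < a%:E)%E /\
                 (a%:E <= prob p (fun j => (k <= j)%N))%E.
  have [||k /= k1 k2] := @first_level (fun n => Pr (fun j => (n < j)%N) < a).
  - by rewrite Pr_gt Pr_le0 subr0 -leNgt ltW.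
  - have := cvgr_gt _ cvg_Pr_le (1 - a); rewrite gtrBl => /(_ _ a0).
    by apply: filterS => n; rewrite Pr_gt; lra.
  - by exists k.+1; rewrite !probE lte_fin lee_fin k1 leNgt k2.
move/(xgetPex 0%N); rewrite -/(top_quantile p a) !probE lte_fin lee_fin.
move=> [k1 k2] /=; split=> //; rewrite lt0n; apply/negP => /eqP k0.
by move: k1; rewrite k0 Pr_gt Pr_le0 subr0 ltNge ltW.
Qed.

Lemma top_removalP a : 0 < a < 1 ->
  let k := top_quantile p a in let r := top_removal p a in
  [/\ fraction r, Ex p r = a, (forall j, (j < k)%N -> r j = 0),
      (forall j, (k < j)%N -> r j = 1) & p k * r k = a - Pr (fun j => (k < j)%N)].
Proof.
move=> a01 k r; have [k1 ka ak] := top_quantileP a01; rewrite -/k in k1 ka ak.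
have rl j : (j < k)%N -> r j = 0 by rewrite /r /top_removal -/k => ->.
have rg j : (k < j)%N -> r j = 1.
  by move=> kj; rewrite /r /top_removal -/k ltnNge ltnW//= kj.
have PD : Pr (fun j => (k <= j)%N) = p k + Pr (fun j => (k < j)%N).
  by apply: PrD1 => //; [rewrite ltnn|move=> j; rewrite leq_eqVlt eq_sym].
have pk : 0 < p k by rewrite PD in ak; lra.
have rk : p k * r k = a - Pr (fun j => (k < j)%N).
  by rewrite /r /top_removal -/k ltnn probE/= mulrC divfK ?gt_eqF.
have fr : fraction r.
  move=> j j1; case: (ltngtP j k) => [/rl ->|/rg ->|->]; rewrite ?lexx ?ler01//.
  rewrite -(ler_pM2l pk) mulr0 -[X in _ && X](ler_pM2l pk) mulr1 rk.
  by rewrite PD in ak; apply/andP; split; lra.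
split=> //; rewrite (_ : Ex p r =
    Ex p (fun j => r k * (j == k)%:R + (k < j)%:R)); last first.
  apply: eq_Ex => j _; case: (ltngtP j k) => [/rl ->|/rg ->|->].
  - by rewrite mulr0 addr0.
  - by rewrite mulr0 add0r.
  - by rewrite mulr1 addr0.
rewrite ExD//; last 2 first.
- by apply: Ex_integrableZ; exact: Ex_integrable_ind.
- exact: Ex_integrable_ind.
by rewrite Ex_eq// rk subrK.
Qed.

Lemma bottom_removalP a : 0 < a < 1 ->
  let l := bottom_quantile p a in let r := bottom_removal p a in
  [/\ fraction r, Ex p r = a, (forall j, (j < l)%N -> r j = 1),
      (forall j, (l < j)%N -> r j = 0) & p l * r l = a - Pr (fun j => (j < l)%N)].
Proof.
move=> a01 l r; have [l1 la al] := bottom_quantileP a01; rewrite -/l in l1 la al.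
have rl j : (j < l)%N -> r j = 1 by rewrite /r /bottom_removal -/l => ->.
have rg j : (l < j)%N -> r j = 0.
  by move=> lj; rewrite /r /bottom_removal -/l ltnNge ltnW//= lj.
have PD : Pr (fun j => (j <= l)%N) = p l + Pr (fun j => (j < l)%N).
  by apply: PrD1 => //; [rewrite ltnn|move=> j; rewrite leq_eqVlt].
have pl : 0 < p l by rewrite PD in al; lra.
have rk : p l * r l = a - Pr (fun j => (j < l)%N).
  by rewrite /r /bottom_removal -/l ltnn probE/= mulrC divfK ?gt_eqF.
have fr : fraction r.
  move=> j j1; case: (ltngtP j l) => [/rl ->|/rg ->|->]; rewrite ?lexx ?ler01//.
  rewrite -(ler_pM2l pl) mulr0 -[X in _ && X](ler_pM2l pl) mulr1 rk.
  by rewrite PD in al; apply/andP; split; lra.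
split=> //; rewrite (_ : Ex p r =
    Ex p (fun j => r l * (j == l)%:R + (j < l)%:R)); last first.
  apply: eq_Ex => j _; case: (ltngtP j l) => [/rl ->|/rg ->|->].
  - by rewrite mulr0 add0r.
  - by rewrite mulr0 addr0.
  - by rewrite mulr1 addr0.
rewrite ExD//; last 2 first.
- by apply: Ex_integrableZ; exact: Ex_integrable_ind.
- exact: Ex_integrable_ind.
by rewrite Ex_eq// rk subrK.
Qed.

Lemma fraction_alpha_seq a r : 0 < a < 1 -> fraction r -> Ex p r = a ->
  alpha_seq p a r.
Proof.
by move=> a01 fr Er; split=> //; rewrite expectE ?Er//; exact: Ex_integrable_fraction.
Qed.

Lemma top_heaviest a r : alpha_seq p a r ->
  alpha_seq p a (top_removal p a) /\ lighter p r (top_removal p a).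
Proof.
move=> ar; have [a01 fr _] := ar.
have [ft Et tl tg _] := top_removalP a01; have [k1 _ _] := top_quantileP a01.
have at_ := fraction_alpha_seq a01 ft Et; split=> //.
apply: (crossing_lighter p_pmf mean_lty ar at_ k1) => j.
  by move=> /fr/andP[r0 _] /tl ->.
by move=> kj; rewrite tg//; have /andP[] := fr j (leq_trans k1 (ltnW kj)).
Qed.

Lemma bottom_lightest a r : alpha_seq p a r ->
  alpha_seq p a (bottom_removal p a) /\ lighter p (bottom_removal p a) r.
Proof.
move=> ar; have [a01 fr _] := ar.
have [fb Eb bl bg _] := bottom_removalP a01; have [l1 _ _] := bottom_quantileP a01.
have ab := fraction_alpha_seq a01 fb Eb; split=> //.
apply: (crossing_lighter p_pmf mean_lty ab ar l1) => j.
  by move=> /fr/andP[_ r1] /bl ->.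
by move=> lj; rewrite bg//; have /andP[] := fr j (leq_trans l1 (ltnW lj)).
Qed.


(** * Critical values *)

(** The second falling factorial of [j]. *)
Definition ff (j : nat) : R := (j * j.-1)%N%:R.

Lemma ff_nondecreasing i j : (1 <= i)%N -> (i <= j)%N -> ff i <= ff j.
Proof. by move=> _ ij; rewrite ler_nat leq_mul// -!subn1 leq_sub2r. Qed.

Lemma ff_inj i j : (1 <= i)%N -> (1 <= j)%N -> i != j -> ff i != ff j.
Proof.
have lt i' j' : (1 <= i')%N -> (i' < j')%N -> ff i' < ff j'.
  case: i' j' => // i' [|j']// _ ij; rewrite ltr_nat /=.
  apply: (@leq_ltn_trans (i'.+1 * j')); first by rewrite leq_mul2l ltnW.
  by rewrite ltn_mul2r ij andbT; exact: leq_ltn_trans (leq0n i') ij.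
by move=> i1 j1; rewrite neq_ltn => /orP[/(lt _ _ i1)|/(lt _ _ j1)] h;
  rewrite ?(lt_eqF h) ?(gt_eqF h).
Qed.

Definition kept_ff r : R := Ex p (fun j => ff j * (1 - r j)).

Lemma Ex_integrable_top a : 0 < a < 1 ->
  Ex_integrable p (fun j => ff j * (1 - top_removal p a j)).
Proof.
move=> a01; have [_ _ _ tg _] := top_removalP a01.
apply: (@Ex_integrable_support _ _ _ (top_quantile p a).+1) => j kj.
by rewrite tg// subrr mulr0.
Qed.

Lemma Ex_integrable_1B r : fraction r -> Ex_integrable p (fun j => 1 - r j).
Proof.
move=> fr; apply: (Ex_integrable_bounded p_pmf mean_lty (C := 1)) => j /fr/andP[r0 r1].
by rewrite ger0_norm ?subr_ge0// gerBl.
Qed.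

Lemma Ex_1B r : fraction r -> Ex p (fun j => 1 - r j) = 1 - Ex p r.
Proof.
move=> fr; rewrite -[X in X - _](Ex1 p_pmf mean_lty) ExB//.
  exact: Ex_integrable_cst.
exact: Ex_integrable_fraction.
Qed.

Lemma fraction_cst a : 0 < a < 1 -> fraction (fun=> a).
Proof. by move=> /andP[a0 a1] j _; rewrite !ltW. Qed.

Lemma Ex_cst a : Ex p (fun=> a) = a.
Proof.
rewrite -[RHS]mulr1 -[in RHS](Ex1 p_pmf mean_lty) -ExZ//.
  by apply: eq_Ex => j _; rewrite mulr1.
exact: Ex_integrable_cst.
Qed.

Lemma kept_ff_cst a : Ex_integrable p ff -> kept_ff (fun=> a) = (1 - a) * Ex p ff.
Proof. by move=> cff; rewrite -ExZ//; apply: eq_Ex => j _; rewrite mulrC. Qed.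

Lemma Ex_integrable_ffM r : Ex_integrable p ff -> fraction r ->
  Ex_integrable p (fun j => ff j * (1 - r j)).
Proof.
move=> cff fr; apply: (Ex_integrable_le p_ge0 _ cff) => j /fr/andP[r0 r1].
by rewrite ger0_norm ?mulr_ge0 ?subr_ge0 ?ler0n// ler_piMr ?ler0n// gerBl.
Qed.

(** Crossing at the quantile between [1 - x] and the kept part of the top removal,
    where [x] is free to have another mass than [a].  With [x] the top removal at
    a level [b >= a] this is the Lipschitz bound, with [x = 1] the decay at
    [a = 1]. *)
Lemma kept_ff_top_le a x : 0 < a < 1 -> fraction x ->
  Ex_integrable p (fun j => ff j * (1 - x j)) ->
  kept_ff (top_removal p a) <= kept_ff x + ff (top_quantile p a) * (Ex p x - a).
Proof.
move=> a01 fx cx.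
have [ft Et tl tg _] := top_removalP a01; have [k1 _ _] := top_quantileP a01.
have := @crossing_le _ _ p_pmf ff _ (fun j => 1 - x j)
  (fun j => 1 - top_removal p a j) ff_nondecreasing k1 _ _
  (Ex_integrable_1B fx) (Ex_integrable_1B ft) cx (Ex_integrable_top a01).
rewrite !Ex_1B// Et -/(kept_ff _) -/(kept_ff _).
set A := kept_ff _; set B := kept_ff _ => H.
suff : A + ff (top_quantile p a) * (1 - Ex p x - (1 - a)) <= B.
  by lra.
apply: H => j.
  by move=> /fx/andP[x0 _] /tl ->; rewrite lerD2l lerN2.
by move=> kj; rewrite tg// lerD2l lerN2; have /andP[] := fx j (leq_trans k1 (ltnW kj)).
Qed.

(** Away from its quantile the top removal is 0 or 1, hence differs from [a]
    there, and a degree that is not constant charges such a point. *)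
Lemma kept_ff_top_lt a : 0 < a < 1 -> nonconstant_degree p -> Ex_integrable p ff ->
  kept_ff (top_removal p a) < (1 - a) * Ex p ff.
Proof.
move=> a01 nc cff; rewrite -kept_ff_cst//.
have [ft Et tl tg _] := top_removalP a01; have [k1 _ _] := top_quantileP a01.
set k := top_quantile p a in tl tg k1.
have fa := fraction_cst a01; have /andP[a0 a1] := a01.
have [i i1 /andP[ik pi]] : exists2 i, (1 <= i)%N & (i != k) && (0 < p i).
  apply: contrapT => ex; have /eqP := nc k k1; apply.
  rewrite -[LHS]mulr1 -(Ex_eq p 1 k1) -[RHS](Ex1 p_pmf mean_lty).
  have c1 : Ex_integrable p (fun=> 1).
    exact: Ex_integrable_cst.
  congr (lim (_ @ \oo)); apply/funext => n; apply: eq_big_nat => j /andP[j1 _].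
  case: eqP => [->|/eqP jk]; first by rewrite mul1r.
  suff -> : p j = 0 by rewrite !mul0r.
  apply/eqP; rewrite eq_le p_ge0// andbT leNgt; apply/negP => pj.
  by apply: ex; exists j => //; rewrite jk.
have := @crossing_lt _ _ p_pmf ff k (fun j => 1 - a)
  (fun j => 1 - top_removal p a j) i ff_nondecreasing k1 _ _
  (Ex_integrable_1B fa) (Ex_integrable_1B ft) (Ex_integrable_ffM cff fa)
  (Ex_integrable_top a01)
  i1 pi (ff_inj i1 k1 ik) _.
rewrite !Ex_1B// Et Ex_cst subrr mulr0 addr0; apply => [j _ /tl ->|j /tg ->|].
- by rewrite subr0 gerBl ltW.
- by rewrite subrr subr_ge0 ltW.
- move: ik; rewrite neq_ltn => /orP[/tl ->|/tg ->].
    by rewrite subr0 lt_eqF// gtrBl.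
  by rewrite subrr gt_eqF// subr_gt0.
Qed.

(** Same crossing, with the bottom removal keeping the large degrees. *)
Lemma kept_ff_bottom_ge a : 0 < a < 1 -> Ex_integrable p ff ->
  (1 - a) * Ex p ff <= kept_ff (bottom_removal p a).
Proof.
move=> a01 cff; rewrite -kept_ff_cst//.
have [fb Eb bl bg _] := bottom_removalP a01; have [l1 _ _] := bottom_quantileP a01.
have fa := fraction_cst a01; have /andP[a0 a1] := a01.
have := @crossing_le _ _ p_pmf ff _ (fun j => 1 - bottom_removal p a j)
  (fun j => 1 - a) ff_nondecreasing l1 _ _
  (Ex_integrable_1B fb) (Ex_integrable_1B fa) (Ex_integrable_ffM cff fb)
  (Ex_integrable_ffM cff fa).
rewrite !Ex_1B// Eb Ex_cst subrr mulr0 addr0; apply => [j _ /bl ->|j /bg ->].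
- by rewrite subrr subr_ge0 ltW.
- by rewrite subr0 gerBl ltW.
Qed.

Lemma top_quantile_antitone a b : 0 < a -> a <= b -> b < 1 ->
  (top_quantile p b <= top_quantile p a)%N.
Proof.
move=> a0 ab b1.
have a01 : 0 < a < 1 by rewrite a0 (le_lt_trans ab).
have b01 : 0 < b < 1 by rewrite b1 (lt_le_trans a0).
have [_ ka _] := top_quantileP a01; have [_ _ kb] := top_quantileP b01.
rewrite leqNgt; apply/negP => kk.
have := lt_le_trans ka (le_trans ab kb); rewrite ltNge => /negP; apply.
apply: le_Ex; [by []|exact: Ex_integrable_ind|exact: Ex_integrable_ind|move=> j _].
by case: (leqP (top_quantile p b) j) => [bj|_]; rewrite ?(leq_trans kk bj) ?ler0n.
Qed.

Lemma alpha_c_top_le b : 0 <= b ->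
  (forall a, 0 < a < 1 -> b < a ->
     kept_ff (top_removal p a) <= Ex p (fun j => j%:R)) ->
  alpha_c_top p <= b.
Proof.
move=> b0 H; rewrite /alpha_c_top; set S := (X in sup X).
have Sb : ubound S b.
  move=> a [a01 /=]; have [_ _ tl tg pr] := top_removalP a01.
  have [k1 _ _] := top_quantileP a01.
  set k := top_quantile p a in tl tg pr k1 *; move=> cond.
  rewrite leNgt; apply/negP => /(H a a01); rewrite leNgt => /negP; apply.
  have cf : Ex_integrable p (fun j => ff j * (j <= k)%N%:R).
    by apply: (@Ex_integrable_support _ _ _ k.+1) => j kj; rewrite leqNgt kj mulr0.
  have E : Ex p (fun j => ff j * (j <= k)%N%:R) =
      kept_ff (top_removal p a) + ff k * (a - Pr (fun j => (k < j)%N)).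
    rewrite -pr mulrCA -Ex_eq// -ExD//; last 2 first.
    - exact: Ex_integrable_top.
    - by apply: Ex_integrableZ; exact: Ex_integrable_ind.
    apply: eq_Ex => j _; case: (ltngtP j k) => [/tl ->|/tg ->|->].
    - by rewrite subr0 mulr0 addr0.
    - by rewrite subrr !mulr0 addr0.
    - by rewrite !mulr1 -mulrDr subrK mulr1.
  move: cond; rewrite meanE// probE expectE// E -EFinB -EFinM -EFinD lte_fin.
  by rewrite ltrD2r.
have [[x Sx]|S0] := pselect (S !=set0); first by apply: ge_sup => //; exists x.
by rewrite sup_out// => -[].
Qed.

(** If E[D(D-1)] is infinite, so is its restriction to degrees above the
    quantile, and the defining inequality holds at every level. *)
Lemma alpha_c_bottom_ge b : 0 < b -> b <= 1 ->
  (forall a, 0 < a < b -> Ex_integrable p ff ->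
     Ex p (fun j => j%:R) < kept_ff (bottom_removal p a)) ->
  b <= alpha_c_bottom p.
Proof.
move=> b0 b1 H; rewrite /alpha_c_bottom; set S := (X in sup X).
have Sub : has_ubound S by exists 1 => a [/andP[_ /ltW]].
have inS a : 0 < a < b -> a <= sup S.
  move=> ab; have a01 : 0 < a < 1.
    by have /andP[-> /= /lt_le_trans] := ab; apply.
  apply: ub_le_sup => //; split=> //=.
  have [fb _ bl bg pr] := bottom_removalP a01.
  have [l1 _ _] := bottom_quantileP a01.
  set l := bottom_quantile p a in bl bg pr l1 *.
  have ca : Ex_integrable p (fun j => ff l * bottom_removal p a l * (j == l)%:R).
    by apply: Ex_integrableZ; exact: Ex_integrable_ind.
  have [cff|ncff] := pselect (Ex_integrable p ff).
    have cb := Ex_integrable_ffM cff fb.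
    have E : Ex p (fun j => ff j * (l <= j)%N%:R) =
        kept_ff (bottom_removal p a) + ff l * (a - Pr (fun j => (j < l)%N)).
      rewrite -pr mulrCA -Ex_eq// -ExD//.
      apply: eq_Ex => j _; case: (ltngtP j l) => [/bl ->|/bg ->|->].
      - by rewrite subrr !mulr0 addr0.
      - by rewrite subr0 mulr0 addr0.
      - by rewrite !mulr1 -mulrDr subrK mulr1.
    rewrite meanE// probE expectE//; last first.
      apply: (Ex_integrable_le p_ge0 _ cff) => j _.
      by case: leq; rewrite ?mulr1 ?mulr0 ?normr0 ?ler0n// ger0_norm ?ler0n.
    by rewrite E -EFinB -EFinM -EFinD lte_fin ltrD2r; exact: H.
  rewrite [ltRHS]expect_pinfty//.
  - by rewrite meanE// probE -EFinB -EFinM -EFinD ltry.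
  - move=> c; apply: ncff.
    apply: (@Ex_integrable_le _ _ p_ge0 _ (fun j => ff j * (l <= j)%N%:R + ff l)).
      move=> j j1; rewrite ger0_norm ?ler0n//; case: (leqP l j) => lj.
        by rewrite mulr1 lerDl ler0n.
      by rewrite mulr0 add0r ff_nondecreasing// ltnW.
    apply: Ex_integrableD => //.
    exact: Ex_integrable_cst.
rewrite leNgt; apply/negP => Sb.
have S0 : b / 2 <= sup S by apply: inS; apply/andP; split; lra.
have := inS ((sup S + b) / 2); suff: 0 < (sup S + b) / 2 < b by move=> -> /(_ isT); lra.
by apply/andP; split; lra.
Qed.

(** A level [b'] below [1 - 1/nu] (below 1 if E[D(D-1)] is infinite) separates
    the two critical values. *)
Lemma alpha_c_lt : (1 < nu p)%E -> nonconstant_degree p ->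
  alpha_c_top p < alpha_c_bottom p.
Proof.
move=> hnu nc; set m := Ex p (fun j => j%:R).
have m0 : 0 < m.
  apply: (@lt_le_trans _ _ 1) => //; rewrite -(Ex1 p_pmf mean_lty).
  apply: le_Ex; rewrite //; last by move=> j j1; rewrite ler1n.
    exact: Ex_integrable_cst.
  exact: Ex_integrable_id.
have [cff|ncff] := pselect (Ex_integrable p ff); last first.
  (* 1/2 is an arbitrary positive level: beyond it the quantile is bounded. *)
  pose K := ff (top_quantile p (2^-1)); have K0 : 0 <= K by rewrite ler0n.
  pose b : R := Num.max 2^-1 (1 - m / (K + 1)).
  have mK : 0 < m / (K + 1) by rewrite divr_gt0// ltr_wpDl.
  have b1 : b < 1 by rewrite gt_max; apply/andP; split; lra.
  apply: (@le_lt_trans _ _ b); last first.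
    by apply: (lt_le_trans b1); apply: alpha_c_bottom_ge.
  apply: alpha_c_top_le; first by rewrite le_max; apply/orP; left; lra.
  move=> a a01; rewrite gt_max => /andP[a2 aK]; have /andP[a0 a1] := a01.
  have f1 : fraction (fun=> 1 : R) by move=> j _; rewrite ler01 lexx.
  have c1 : Ex_integrable p (fun j => ff j * (1 - 1)).
    by apply: (@Ex_integrable_support _ _ _ 0) => j _; rewrite subrr mulr0.
  apply: (le_trans (kept_ff_top_le a01 f1 c1)).
  rewrite Ex_cst [X in X + _](_ : _ = 0) ?add0r; last first.
    by rewrite /kept_ff (@Ex_support _ _ _ 0) ?/psum ?big_geq// => j _;
      rewrite subrr mulr0.
  have kK : ff (top_quantile p a) <= K.
    apply: ff_nondecreasing; first by have [] := top_quantileP a01.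
    by apply: top_quantile_antitone => //; lra.
  apply: (@le_trans _ _ (K * (m / (K + 1)))).
    by apply: ler_pM; rewrite ?ler0n//; lra.
  by rewrite mulrCA ler_piMr ?(ltW m0)// ler_pdivrMr ?mul1r ?lerDl// ltr_wpDl.
set W := Ex p ff.
have mW : m < W.
  move: hnu; rewrite /nu meanE// expectE// -/m -/W inver gt_eqF// -EFinM lte_fin.
  by rewrite ltr_pdivlMr// mul1r.
have W0 := lt_trans m0 mW.
(* The critical level of uniform removal. *)
pose b := 1 - m / W.
have bW : (1 - b) * W = m by rewrite /b opprB addrC subrK divfK ?gt_eqF.
have b01 : 0 < b < 1.
  by rewrite subr_gt0 ltr_pdivrMr// mul1r mW/= gtrBl divr_gt0.
have /andP[b0 b1] := b01.
have Tb : kept_ff (top_removal p b) < m by rewrite -bW; exact: kept_ff_top_lt.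
set T := kept_ff _ in Tb.
(* K is a Lipschitz constant on [b / 2, b]; adding 1 keeps the divisor positive. *)
pose K := ff (top_quantile p (b / 2)); have K0 : 0 <= K by rewrite ler0n.
pose b' : R := Num.max (b / 2) (b - (m - T) / (K + 1)).
have mK : 0 < (m - T) / (K + 1) by rewrite divr_gt0 ?subr_gt0// ltr_wpDl.
have bb' : b' < b by rewrite gt_max; apply/andP; split; lra.
apply: (@le_lt_trans _ _ b'); last first.
  apply: (lt_le_trans bb'); apply: alpha_c_bottom_ge => //; first exact: ltW.
  move=> a /andP[a0 ab] _; have a01 : 0 < a < 1 by rewrite a0 (lt_trans ab).
  apply: lt_le_trans (kept_ff_bottom_ge a01 cff).
  by rewrite -/m -bW ltr_pM2r// ltrD2l ltrN2.
apply: alpha_c_top_le; first by rewrite le_max; apply/orP; left; lra.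
move=> a a01; rewrite gt_max => /andP[a2 aK]; have /andP[a0 a1] := a01.
case: (leP b a) => [ba|/ltW ab].
  apply: (le_trans (ltW (kept_ff_top_lt a01 nc cff))).
  by rewrite -/m -bW ler_pM2r// lerD2l lerN2.
have [fb Eb _ _ _] := top_removalP b01.
apply: (le_trans (kept_ff_top_le a01 fb (Ex_integrable_top b01))).
rewrite Eb -/T -/m -lerBrDl.
have kK : ff (top_quantile p a) <= K.
  apply: ff_nondecreasing; first by have [] := top_quantileP a01.
  by apply: top_quantile_antitone => //; lra.
apply: (@le_trans _ _ (K * ((m - T) / (K + 1)))).
  by apply: ler_pM; rewrite ?ler0n//; lra.
rewrite mulrCA ler_piMr ?subr_ge0 ?(ltW Tb)//.
by rewrite ler_pdivrMr ?mul1r ?lerDl// ltr_wpDl.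
Qed.

End Quantiles.

Theorem theorem1p4 (R : realType) (d : forall n : nat, 'I_n -> nat)
    (p : nat -> R) (hd : degree_conditions d p) (hnu : (1 < nu p)%E) :
  (forall (a : R) (r r' : nat -> R),
      alpha_seq p a r -> alpha_seq p a r' -> stoch_le p r' r ->
      [/\ rho p a (top_removal p a) <= rho p a r,
          rho p a r <= rho p a r'
        & rho p a r' <= rho p a (bottom_removal p a)] /\
      [/\ edges p a (top_removal p a) <= edges p a r,
          edges p a r <= edges p a r'
        & edges p a r' <= edges p a (bottom_removal p a)]) /\
  (nonconstant_degree p -> alpha_c_top p < alpha_c_bottom p).
Proof.
have [_ p_pmf _ _ mean_lty] := hd.
split=> [a r r' ar ar' rr'|]; last exact: alpha_c_lt.
have giant := lighter_giant p_pmf mean_lty.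
have [at_ rt] := top_heaviest p_pmf mean_lty ar.
have [ab br'] := bottom_lightest p_pmf mean_lty ar'.
have r'r := stoch_le_lighter p_pmf mean_lty ar ar' rr'.
have [? ?] := giant _ _ _ ar at_ rt.
have [? ?] := giant _ _ _ ar' ar r'r.
by have [? ?] := giant _ _ _ ab ar' br'.
Qed.
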